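(* Given a pointed quasimetric space $(\mathcal M,\rho)$ with metric envelope $(\widetilde{\mathcal M},\widetilde\rho)$, the following are equivalent: (1) $(\widetilde{\mathcal M},\widetilde\rho)$ is trivial (i.e., it consists of a single point). (2) $\mathrm{Lip}_0(\mathcal M,M)=\{0\}$ for any (pointed) metric space $(M,d)$. (3) $\mathrm{Lip}_0(\mathcal M)=\{0\}$.
   Context: A quasimetric on a nonempty set $\mathcal M$ is a symmetric map $\rho\colon\mathcal M\times\mathcal M\to[0,\infty)$ such that $\rho(x,y)=0$ iff $x=y$ and, for some constant $\kappa\ge1$, $\rho(x,z)\le\kappa(\rho(x,y)+\rho(y,z))$ for all $x,y,z\in\mathcal M$. A pointed space has a distinguished point $0$. For $x,y\in\mathcal M$ put $\widetilde\rho(x,y)=\inf\sum_{i=0}^n\rho(x_i,x_{i+1})$, the infimum being over all finite sequences $x=x_0,x_1,\dots,x_{n+1}=y$ of points of $\mathcal M$. Let $x\sim y$ iff $\widetilde\rho(x,y)=0$ and $\widetilde{\mathcal M}=\mathcal M/\!\sim$, with the induced metric $\widetilde\rho$ on equivalence classes. $(\widetilde{\mathcal M},\widetilde\rho)$ is the metric envelope of $(\mathcal M,\rho)$. For a pointed metric space $(M,d)$, $\mathrm{Lip}_0(\mathcal M,M)$ is the set of all maps $f\colon\mathcal M\to M$ with $f(0)=0$ for which there is $C\ge0$ with $d(f(x),f(y))\le C\rho(x,y)$ for all $x,y$; $\mathrm{Lip}_0(\mathcal M,M)=\{0\}$ means that the only such map is the constant map with value the base point of $M$. $\mathrm{Lip}_0(\mathcal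 M)=\mathrm{Lip}_0(\mathcal M,\mathbb R)$ with $\mathbb R$ carrying its usual metric and base point $0$. *)

(* Defs.v *)
From HB Require Import structures.
From mathcomp Require Import all_boot all_order all_algebra generic_quotient.
From mathcomp Require Import all_classical all_reals topology normedtype.
From mathcomp Require Import lra.
Set Implicit Arguments.
Unset Strict Implicit.
Unset Printing Implicit Defensive.
Import Order.TTheory GRing.Theory Num.Theory numFieldNormedType.Exports.
Local Open Scope classical_set_scope.
Local Open Scope ring_scope.
Local Open Scope quotient_scope.

HB.mixin Record isQuasiMetric (R : realType) (X : Type) & Choice X := {
  qdist : X -> X -> R ;
  qdist_ge0 : forall x y, 0 <= qdist x y ;
  qdist_sym : forall x y, qdist x y = qdist y x ;
  qdist_eq0 : forall x y, qdist x y = 0 <-> x = y ;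
  qdist_triangle : exists2 kappa : R, 1 <= kappa &
    forall x y z, qdist x z <= kappa * (qdist x y + qdist y z)
}.

#[short(type="quasiMetricType")]
HB.structure Definition QuasiMetric (R : realType) :=
  { X of Choice X & isQuasiMetric R X }.

Section envelope.
Context {R : realType} {X : quasiMetricType R}.
Implicit Types x y z : X.

(* Lengths of the finite chains c 0, ..., c n.+1 from x to y; the values of c
   beyond n.+1 are irrelevant. *)
Definition chain_lengths x y : set R :=
  [set l | exists n (c : nat -> X), [/\ c 0%N = x, c n.+1 = y &
     l = \sum_(i < n.+1) qdist (c i) (c i.+1)]].

Definition env_dist x y : R := inf (chain_lengths x y).

Lemma chain_lengths_ge0 x y l : chain_lengths x y l -> 0 <= l.
Proof. by move=> [n [c [_ _ ->]]]; apply: sumr_ge0 => i _; exact: qdist_ge0. Qed.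

Lemma chain_lengths1 x y : chain_lengths x y (qdist x y).
Proof.
by exists 0%N, (fun i => if i is 0%N then x else y); rewrite big_ord1.
Qed.

Lemma has_inf_chain_lengths x y : has_inf (chain_lengths x y).
Proof.
split; first by exists (qdist x y); exact: chain_lengths1.
by exists 0 => l /chain_lengths_ge0.
Qed.

Lemma chain_lengths_sym x y l : chain_lengths x y l -> chain_lengths y x l.
Proof.
move=> [n [c [c0 cn ->]]]; exists n, (fun i => c (n.+1 - i)%N).
split; [by rewrite subn0|by rewrite subnn|].
rewrite (reindex_inj rev_ord_inj) /=; apply: eq_bigr => i _.
rewrite qdist_sym; congr qdist; congr c.
by rewrite subSS subSn // -ltnS.
Qed.

Lemma chain_lengths_cat x y z l m :
  chain_lengths x y l -> chain_lengths y z m -> chain_lengths x z (l + m).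
Proof.
move=> [n [c [c0 cn ->]]] [k [d [d0 dk ->]]].
exists (n + k.+1)%N, (fun i => if (i <= n)%N then c i else d (i - n.+1)%N).
split => //.
  by rewrite ltnNge leq_addr /= -addSn addKn.
rewrite -addSn big_split_ord /=; congr (_ + _); apply: eq_bigr => i _ /=.
  have := ltn_ord i; rewrite ltnS => lein; rewrite lein.
  case: (ltnP i n) => // leni.
  have -> : nat_of_ord i = n by apply/eqP; rewrite eqn_leq lein leni.
  by rewrite subnn d0 -cn.
have -> : (n.+1 + i <= n)%N = false by rewrite leqNgt addSn ltnS leq_addr.
have -> : (n.+1 + i < n)%N = false by rewrite ltnNge addSn -addnS leq_addr.
by rewrite addKn -addnS addKn.
Qed.

Lemma env_dist_ge0 x y : 0 <= env_dist x y.
Proof.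
apply: lb_le_inf; first by have [] := has_inf_chain_lengths x y.
by move=> l /chain_lengths_ge0.
Qed.

Lemma env_dist_le x y l : chain_lengths x y l -> env_dist x y <= l.
Proof. by move=> xyl; apply: ge_inf => //; have [] := has_inf_chain_lengths x y. Qed.

Lemma env_distxx x : env_dist x x = 0.
Proof.
apply/eqP; rewrite eq_le env_dist_ge0 andbT.
by have := env_dist_le (chain_lengths1 x x); rewrite (qdist_eq0 x x).2.
Qed.

Lemma env_dist_sym x y : env_dist x y = env_dist y x.
Proof.
by congr inf; apply/seteqP; split => l; exact: chain_lengths_sym.
Qed.

Lemma env_dist_triangle y x z : env_dist x z <= env_dist x y + env_dist y z.
Proof.
apply/ler_addgt0Pr => e e0; have e2 : 0 < e / 2 by rewrite divr_gt0.
have [l xyl ll] := inf_adherent e2 (has_inf_chain_lengths x y).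
have [m yzm lm] := inf_adherent e2 (has_inf_chain_lengths y z).
have := env_dist_le (chain_lengths_cat xyl yzm).
rewrite -/(env_dist x y) -/(env_dist y z) in ll lm; lra.
Qed.

Definition env_rel : rel X := fun x y => env_dist x y == 0.

Lemma env_rel_refl : reflexive env_rel.
Proof. by move=> x; rewrite /env_rel env_distxx. Qed.

Lemma env_rel_sym : symmetric env_rel.
Proof. by move=> x y; rewrite /env_rel env_dist_sym. Qed.

Lemma env_rel_trans : transitive env_rel.
Proof.
move=> y x z /eqP xy /eqP yz; rewrite /env_rel eq_le env_dist_ge0 andbT.
by have := env_dist_triangle y x z; rewrite xy yz addr0.
Qed.

Canonical env_equiv := EquivRel env_rel env_rel_refl env_rel_sym env_rel_trans.

End envelope.

Definition envelope (R : realType) (X : quasiMetricType R) : Type :=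
  {eq_quot @env_equiv R X}.

Section envelope_metric.
Context {R : realType} {X : quasiMetricType R}.

HB.instance Definition _ := Choice.on (envelope X).
HB.instance Definition _ := EqQuotient.on (envelope X).

(* The metric is computed on the chosen representatives; mdist_pi below shows
   that it does not depend on them. *)
Let dist (u v : envelope X) : R := env_dist (repr u) (repr v).

Let env_dist_pil (x y z : X) : env_rel x y -> env_dist x z = env_dist y z.
Proof.
move=> /eqP xy; have yx : env_dist y x = 0 by rewrite env_dist_sym.
have := env_dist_triangle y x z; have := env_dist_triangle x y z.
by rewrite xy yx !add0r => h1 h2; apply/eqP; rewrite eq_le h1 h2.
Qed.

Let dist_pi (x y : X) :
  dist (\pi_(envelope X) x) (\pi_(envelope X) y) = env_dist x y.
Proof.
have rel_repr z : env_rel (repr (\pi_(envelope X) z)) z.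
  by apply/eqmodP; rewrite reprK.
rewrite /dist (env_dist_pil _ (rel_repr x)) env_dist_sym.
by rewrite (env_dist_pil _ (rel_repr y)) env_dist_sym.
Qed.

Let distxx u : dist u u = 0.
Proof. exact: env_distxx. Qed.

Let dist_positivity u v : dist u v = 0 -> u = v.
Proof. by move=> /eqP uv; rewrite -[u]reprK -[v]reprK; apply/eqmodP. Qed.

Let dist_sym u v : dist u v = dist v u.
Proof. exact: env_dist_sym. Qed.

Let dist_triangle v u w : dist u w <= dist u v + dist v w.
Proof. exact: env_dist_triangle. Qed.

HB.instance Definition _ := @isMetric.Build R (envelope X)
  dist distxx dist_positivity dist_sym dist_triangle.

Lemma mdist_pi (x y : X) :
  mdist (\pi_(envelope X) x) (\pi_(envelope X) y) = env_dist x y.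
Proof. exact: dist_pi. Qed.

End envelope_metric.

Definition Lip0 (R : realType) (X : quasiMetricType R) (o : X)
    (M : metricType R) (p : M) : set (X -> M) :=
  [set f | f o = p /\ exists2 C : R, 0 <= C &
     forall x y, mdist (f x) (f y) <= C * qdist x y].

(* Main.v *)
Require Import Defs.
From mathcomp Require Import all_boot all_order all_algebra.
From mathcomp Require Import all_classical all_reals topology normedtype.
Import Order.TTheory GRing.Theory Num.Theory.
Import numFieldNormedType.Exports.
Local Open Scope classical_set_scope.
Local Open Scope ring_scope.

(** The metric envelope is the universal metric quotient of [X]: chaining the
    Lipschitz inequality along the points joining [x] to [y] and applying the
    triangle inequality in the target shows that a map which is [C]-Lipschitz
    for the quasimetric is [C]-Lipschitz for [env_dist] ([lipschitz_env_dist]).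
    Hence, when all points of [X] are at envelope distance zero, every
    Lipschitz map into a metric space is constant.  The real line is one such
    target, and it suffices to detect nontriviality: the envelope distance to
    the base point is itself a real-valued [1]-Lipschitz function vanishing at
    the base point ([Lip0_env_dist]), so if the only such function is zero,
    then every point is identified with the base point in the envelope. *)

Lemma mdist_le_sum (R : realType) (M : metricType R) (c : nat -> M) n :
  mdist (c 0%N) (c n) <= \sum_(i < n) mdist (c i) (c i.+1).
Proof.
elim: n => [|n IHn]; first by rewrite big_ord0 mdistxx.
rewrite big_ord_recr /=; apply: le_trans (metric_triangle _ (c n) _) _.
by rewrite lerD2r.
Qed.

Lemma lipschitz_env_dist (R : realType) (X : quasiMetricType R)
    (M : metricType R) (f : X -> M) (C : R) : 0 <= C ->
  (forall x y, mdist (f x) (f y) <= C * qdist x y) ->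
  forall x y, mdist (f x) (f y) <= C * env_dist x y.
Proof.
move=> C0 fC x y.
have chainC l : chain_lengths x y l -> mdist (f x) (f y) <= C * l.
  move=> [n [c [<- <- ->]]].
  apply: le_trans (mdist_le_sum _ _ (f \o c) _) _.
  by rewrite mulr_sumr; apply: ler_sum => i _; exact: fC.
have [xy_ne _] := has_inf_chain_lengths x y.
(* Dividing by [C] to pass to the infimum requires treating [C = 0] apart. *)
move: C0; rewrite le_eqVlt => /predU1P[C0|C0].
  by have [l /chainC] := xy_ne; rewrite -C0 !mul0r.
rewrite mulrC -ler_pdivrMr //; apply: lb_le_inf => // l /chainC.
by rewrite ler_pdivrMr // mulrC.
Qed.

Lemma Lip0_cst (R : realType) (X : quasiMetricType R) (o : X)
    (M : metricType R) (p : M) : Lip0 o p (cst p).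
Proof. by split=> //; exists 0 => // x y; rewrite mdistxx mul0r. Qed.

(** [env_dist] satisfies the genuine triangle inequality, with no constant
    [kappa]; this is what makes the distance to a point Lipschitz, whereas the
    same function built from [qdist] need not be. *)
Lemma Lip0_env_dist (R : realType) (X : quasiMetricType R) (o : X) :
  Lip0 o (0 : R^o) (fun x => env_dist x o : R^o).
Proof.
split; first exact: env_distxx.
exists 1 => // x y; rewrite mul1r.
apply: le_trans (env_dist_le (chain_lengths1 x y)).
(* The metric of [R^o] unfolds to the norm of the difference [y - x]. *)
change (`|env_dist y o - env_dist x o| <= env_dist x y).
rewrite ler_distl lerBlDr [env_dist y o + _]addrC env_dist_triangle /=.
by rewrite addrC (env_dist_sym x y) env_dist_triangle.
Qed.

Lemma envelope_trivialP (R : realType) (X : quasiMetricType R) (o : X) :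
  (exists c : envelope X, [set: envelope X] = [set c]) <->
  (forall x : X, env_dist x o = 0).
Proof.
split=> [[c cE] x|xo].
  have inc (u : envelope X) : u = c.
    by have : [set: envelope X] u by []; rewrite cE.
  by rewrite -mdist_pi (inc (\pi x)%qT) (inc (\pi o)%qT) mdistxx.
exists (\pi_(envelope X) o)%qT; apply/seteqP; split=> // u _ /=.
by rewrite -[u]generic_quotient.reprK; apply: mdist_positivity; rewrite mdist_pi.
Qed.

Theorem proposition3p5 (R : realType) (X : quasiMetricType R) (o : X) :
  [<-> exists c : envelope X, [set: envelope X] = [set c];
       forall (M : metricType R) (p : M), Lip0 o p = [set cst p];
       Lip0 o (0 : R^o) = [set cst 0] ].
Proof.
tfae.
- move=> /(envelope_trivialP _ _ o) xo M p; apply/seteqP; split=> f /=.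
    move=> [fo [C C0 fC]]; apply/funext => x; apply: mdist_positivity.
    apply/eqP; rewrite eq_le mdist_ge0 andbT -fo.
    by have := lipschitz_env_dist _ _ _ _ _ C0 fC x o; rewrite xo mulr0.
  by move=> ->; exact: Lip0_cst.
- by move=> LipM; exact: LipM.
- move=> LipR; apply/(envelope_trivialP _ _ o) => x.
  by have := Lip0_env_dist R X o; rewrite LipR => /(congr1 (@^~ x)).
Qed.
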